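(* Let $r\ge2$ be an integer and $K$ a triangle. The space $R^{r-2}(K)$ takes the form \[ R^{r-2}(K)=\operatorname{span}\bigl\{P_{k,r-2}^{(2,2,2)}(\lambda_1,\lambda_2,\lambda_3)\ :\ 0\le k\le r-2\bigr\}. \]
   Context: $K$ is a triangle with barycentric coordinates $\lambda_1,\lambda_2,\lambda_3$ and $b_K=\lambda_1\lambda_2\lambda_3$. With $\mathbb P_m=\{0\}$ for $m<0$, \[ R^{r-2}(K)=\Bigl\{v\in\mathbb P_{r-2}(K):\int_K b_K^2 v q\,d\boldsymbol x=0\ \text{for all }q\in\mathbb P_{r-3}(K)\Bigr\}. \] $P_n^{(\alpha,\beta)}$ ($\alpha,\beta>-1$) is the Jacobi polynomial given by \[ (1-t)^\alpha(1+t)^\beta P_n^{(\alpha,\beta)}(t)=\frac{(-1)^n}{2^nn!}\frac{d^n}{dt^n}\bigl((1-t)^{n+\alpha}(1+t)^{n+\beta}\bigr), \] and for integers $0\le k\le n$ and $\alpha,\beta,\gamma>-1$, on $\lambda_1+\lambda_2+\lambda_3=1$, \[ P_{k,n}^{(\alpha,\beta,\gamma)}(\lambda_1,\lambda_2,\lambda_3)=(\lambda_2+\lambda_3)^kP_{n-k}^{(2k+\beta+\gamma+1,\alpha)}(\lambda_1-\lambda_2-\lambda_3)\,P_k^{(\gamma,\beta)}\Bigl(\frac{\lambda_2-\lambda_3}{\lambda_2+\lambda_3}\Bigr), \] which is a polynomial in $\mathbb P_n(K)$. *)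

(* Defs.v *)
From HB Require Import structures.
From mathcomp Require Import all_boot all_order all_algebra.
From mathcomp Require Import all_classical all_reals all_analysis.
From mathcomp Require mpoly.
From mathcomp Require Import ring lra.
(* mpoly's notations clash with those of MathComp-Analysis *)
Import -(notations) mpoly.

Set Implicit Arguments.
Unset Strict Implicit.
Unset Printing Implicit Defensive.
Import Order.TTheory GRing.Theory Num.Theory numFieldNormedType.Exports.
Local Open Scope classical_set_scope.
Local Open Scope ring_scope.

(* twice the signed area of the triangle p q s *)
Definition sarea (R : realType) (p q s : R * R) : R :=
  (q.1 - p.1) * (s.2 - p.2) - (q.2 - p.2) * (s.1 - p.1).

Record triangle (R : realType) := Triangle {
  vtx1 : R * R;
  vtx2 : R * R;
  vtx3 : R * R;
  vtx_nondegenerate : sarea vtx1 vtx2 vtx3 != 0 }.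

Definition tri_set (R : realType) (K : triangle R) : set (R * R) :=
  [set x | exists t1 t2 t3 : R,
    [/\ 0 <= t1, 0 <= t2, 0 <= t3, t1 + t2 + t3 = 1 &
        x = t1 *: vtx1 K + t2 *: vtx2 K + t3 *: vtx3 K]].

Section barycentric.
Variables (R : realType) (K : triangle R).
Implicit Type x : R * R.

Definition lambda1 x := sarea x (vtx2 K) (vtx3 K) / sarea (vtx1 K) (vtx2 K) (vtx3 K).
Definition lambda2 x := sarea (vtx1 K) x (vtx3 K) / sarea (vtx1 K) (vtx2 K) (vtx3 K).
Definition lambda3 x := sarea (vtx1 K) (vtx2 K) x / sarea (vtx1 K) (vtx2 K) (vtx3 K).

Lemma lambda_sum x : lambda1 x + lambda2 x + lambda3 x = 1.
Proof.
move: (vtx_nondegenerate K); rewrite /lambda1 /lambda2 /lambda3 /sarea => ?.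
by field.
Qed.

Lemma lambda_decomp x :
  x = lambda1 x *: vtx1 K + lambda2 x *: vtx2 K + lambda3 x *: vtx3 K.
Proof.
case: x => x y; move: (vtx_nondegenerate K).
rewrite /lambda1 /lambda2 /lambda3 /sarea => ?.
by congr pair => /=; rewrite /GRing.scale /=; field.
Qed.

Definition bubble x := lambda1 x * lambda2 x * lambda3 x.

End barycentric.

(* P_m(K): restrictions to K of polynomials of total degree <= m *)
Definition poly_space (R : realType) (K : triangle R) (m : int) :
    set (tri_set K -> R) :=
  match m with
  | Posz d => [set f | exists2 p : mpoly 2 R, (msize p <= d.+1)%N &
      forall x : tri_set K, f x =
        meval (fun i : 'I_2 => if i == ord0 then (\val x).1 else (\val x).2) p]
  | Negz _ => [set f | forall x, f x = 0]
  end.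

Definition integral_tri (R : realType) (K : triangle R) (f : tri_set K -> R) : R :=
  (\int[(lebesgue_measure \x lebesgue_measure)%E]_(x in tri_set K) 'valL_0 f x)%R.

(* the space denoted R^{r-2}(K) *)
Definition R_space (R : realType) (K : triangle R) (r : nat) :
    set (tri_set K -> R) :=
  [set v | poly_space (r%:Z - 2) v /\
    forall q : tri_set K -> R, poly_space (r%:Z - 3) q ->
      integral_tri (fun x => bubble K (\val x) ^+ 2 * v x * q x) = 0].

Arguments R_space {R} K r.

Definition lin_span (R : realType) (T : Type) (n : nat) (f : 'I_n -> T -> R) :
    set (T -> R) :=
  [set v | exists c : 'I_n -> R, forall x, v x = \sum_(k < n) c k * f k x].

Section jacobi.
Variable R : realType.
Implicit Types (n : nat) (al be t : R).

Definition rodrigues n al be (p : {poly R}) : Prop :=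
  forall t, -1 < t < 1 ->
    (1 - t) `^ al * (1 + t) `^ be * p.[t] =
    (-1) ^+ n / (2 ^+ n * n`!%:R) *
    ((fun s => (1 - s) `^ (n%:R + al) * (1 + s) `^ (n%:R + be))^`(n))%classic t.

Definition jacobi n al be : {poly R} := xget 0 [set p | rodrigues n al be p].

Local Lemma derive_jacobi_weight (a b : R) (q : {poly R}) t : -1 < t < 1 ->
  is_derive t 1 (fun s : R => (1 - s) `^ a * (1 + s) `^ b * q.[s])
   ((1 - t) `^ (a - 1) * (1 + t) `^ (b - 1) *
    (- a * (1 + t) * q.[t] + b * (1 - t) * q.[t] + (1 - t) * (1 + t) * q^`().[t])).
Proof.
move=> /andP[t1 t2].
have h1 : 0 < 1 - t by lra.
have h2 : 0 < 1 + t by lra.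
have d1 : is_derive t 1 (fun s : R => 1 - s) (-1).
  by have := is_deriveB (is_derive_cst (1 : R) t 1) (is_derive_id t 1);
    rewrite sub0r; apply.
have d2 : is_derive t 1 (fun s : R => 1 + s) 1.
  by have := is_deriveD (is_derive_cst (1 : R) t 1) (is_derive_id t 1);
    rewrite add0r; apply.
have f1 := is_derive1_comp (f := fun y => y `^ a) (g := fun s => 1 - s)
  (is_derive1_powR a h1) d1.
have f2 := is_derive1_comp (f := fun y => y `^ b) (g := fun s => 1 + s)
  (is_derive1_powR b h2) d2.
have f3 := is_derive_poly q t.
have := is_deriveM (is_deriveM f1 f2) f3.
move=> /is_derive_eq; apply.
rewrite [X in X *: _](_ : _ = (1 - t) `^ a * (1 + t) `^ b)// /GRing.scale /=.
have E c (y : R) : 0 < y -> y `^ c = y `^ (c - 1) * y.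
  move=> y0; rewrite -[X in _ * X](powRr1 (ltW y0)) -powRD ?subrK//.
  by rewrite (gt_eqF y0) implybT.
rewrite (E a _ h1) (E b _ h2). ring.
Qed.

Local Lemma derive1n_jacobi_weight (a b : R) m : exists q : {poly R},
  forall t, -1 < t < 1 ->
  ((fun s => (1 - s) `^ a * (1 + s) `^ b)^`(m))%classic t =
  (1 - t) `^ (a - m%:R) * (1 + t) `^ (b - m%:R) * q.[t].
Proof.
elim: m => [|m [q IH]].
  by exists 1 => t _; rewrite derive1n0 !subr0 hornerC mulr1.
exists (- (a - m%:R) *: (1 + 'X) * q + (b - m%:R) *: (1 - 'X) * q +
        (1 - 'X) * (1 + 'X) * q^`()) => t t11.
rewrite derive1nS derive1E.
have D := @derive_jacobi_weight (a - m%:R) (b - m%:R) q t t11.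
have /near_eq_derive -> : \forall s \near t,
    ((fun s => (1 - s) `^ a * (1 + s) `^ b)^`(m))%classic s =
    (1 - s) `^ (a - m%:R) * (1 + s) `^ (b - m%:R) * q.[s].
  case/andP: t11 => t1 t2.
  apply: (@nbhs_interval _ _ _ (-1)%:E 1%:E); rewrite ?lte_fin// => y.
  by rewrite !lte_fin => y1 y2; apply: IH; rewrite y1.
rewrite (@derive_val _ _ _ _ _ _ _ D) -natr1 !opprD !addrA.
by rewrite !hornerE; ring.
Qed.

Lemma rodrigues_jacobi n al be : rodrigues n al be (jacobi n al be).
Proof.
rewrite /jacobi; case: xgetP => [//|/= none] /=.
have [q qE] := derive1n_jacobi_weight (n%:R + al) (n%:R + be) n.
case: (none (((-1) ^+ n / (2 ^+ n * n`!%:R)) *: q)) => t t11.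
by rewrite qE// hornerZ ![n%:R + _]addrC !addrK; ring.
Qed.

Lemma rodrigues_unique n al be (p q : {poly R}) :
  rodrigues n al be p -> rodrigues n al be q -> p = q.
Proof.
move=> hp hq; apply/eqP; rewrite -subr_eq0; apply/negP => /negP pq0.
pose s := [seq (i.+2%:R^-1 : R) | i <- iota 0 (size (p - q))].
suff: (size s < size (p - q)%R)%N by rewrite size_map size_iota ltnn.
apply: max_poly_roots => //.
  apply/allP => _ /mapP[i _ ->].
  have i0 : 0 < i.+2%:R :> R by rewrite ltr0n.
  have i1 : i.+2%:R^-1 < 1 :> R by rewrite invf_lt1// ltr1n.
  have i2 : 0 < i.+2%:R^-1 :> R by rewrite invr_gt0.
  have t11 : -1 < (i.+2%:R^-1 : R) < 1 by rewrite i1 andbT (lt_trans _ i2)// ltrN10.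
  have := etrans (hp _ t11) (esym (hq _ t11)) => /mulfI; rewrite /root !hornerE => -> //.
    by rewrite subrr.
  by rewrite mulf_neq0// gt_eqF// powR_gt0// ?subr_gt0// addr_gt0.
rewrite map_inj_uniq ?iota_uniq// => i j /invr_inj/eqP.
by rewrite eqr_nat => /eqP[].
Qed.

End jacobi.

(* P_{k,n}^{(al,be,ga)}(lambda1,lambda2,lambda3) on K. Where lambda2 + lambda3 = 0
   (only at the vertex vtx1 K) the quotient is 0 in Rocq, and the formula gives
   the value of the polynomial: 0 for k > 0, as 0 ^+ k = 0, while for k = 0 the
   last factor is constant. *)
Definition jacobi_tri (R : realType) (K : triangle R) (al be ga : R)
    (k n : nat) (x : tri_set K) : R :=
  let l1 := lambda1 K (\val x) in
  let l2 := lambda2 K (\val x) in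
  let l3 := lambda3 K (\val x) in
  (l2 + l3) ^+ k *
  (jacobi (n - k)%N (2 * k%:R + be + ga + 1) al).[l1 - l2 - l3] *
  (jacobi k ga be).[(l2 - l3) / (l2 + l3)].
Arguments jacobi_tri {R} K al be ga k n x.

(* Main.v *)
Require Import Defs.
From HB Require Import structures.
From mathcomp Require Import all_boot all_order all_algebra.
From mathcomp Require Import all_classical all_reals all_analysis.
From mathcomp Require Import measurable_realfun.
From mathcomp Require mpoly.
From mathcomp Require Import ring lra zify.
Import -(notations) mpoly.

Set Implicit Arguments.
Unset Strict Implicit.
Unset Printing Implicit Defensive.
Import Order.TTheory GRing.Theory Num.Theory numFieldNormedType.Exports.

(** Put [s = lambda2 + lambda3], [d = lambda2 - lambda3], so that
    [lambda1 = 1 - s] and [4 b_K = (1 - s) (s^2 - d^2)], and write [n] for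
    [r - 2] and [U k n] for the polynomial [P_{k,n}^{(2,2,2)}].

    Orthogonality of [U k n] to degree [< n].  Affine changes of variables are
    replaced by one fact: the integral over [K] of a directional derivative of a
    multiple of [b_K] is zero ([tri_int_dirder]).  Along a line parallel to an
    axis, [K] cuts out a segment at whose ends [b_K] vanishes, so the fundamental
    theorem of calculus gives zero on each line, and Fubini does the rest.  From
    there on the argument is algebra with the derivations [d/ds] and [d/dd].  It
    is enough to test [U k n] against [s^i d^j] with [i + j < n], and then
    [b_K^2 * U k n * s^i * d^j] is, up to a constant, [f(s) h(s, d)] where
    [f = (1 - s)^2 s^i P_{n-k}(1 - 2s)] and [h] is the homogenization of degree
    [k + j + 4] of [g(u) = (1 - u^2)^2 P_k(u) u^j].
    - If [j < k], then [g] integrates to zero on [[-1, 1]], so its primitive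
      vanishes at both ends and [f h] is a [d/dd]-derivative of a multiple of
      [b_K] ([functional_homogenize_deriv]).
    - If [j >= k], then [i + j - k < n - k] and the orthogonality of the outer
      Jacobi polynomial provides [Phi], divisible by [1 - s], such that [f h] is
      the divergence of [Phi(s) h (s, d)] ([functional_radial]).
    In both cases the orthogonality of the one-variable Jacobi polynomials is
    Rodrigues' formula integrated by parts, stated as the existence of a
    primitive vanishing at the end points ([jacobi_orth], [jacobi_radial]).

    Spanning.  The part of degree [n] of [U k n] is a nonzero multiple of
    [s^(n-k) d^k] plus terms [s^(n-i) d^i] with [i < k], because both Jacobi
    polynomials have full degree.  Hence every polynomial of degree at most [n] is
    a combination of the [U k n] plus some [w] of degree [< n]
    ([jacobi_alg_span]).  If it lies in [R^n(K)], then [w] is orthogonal to itself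
    for the weight [b_K^2], so [b_K w] vanishes inside [K] and [w] vanishes on
    [K]. *)

Local Open Scope classical_set_scope.
Local Open Scope ring_scope.

(** * Jacobi polynomials with natural exponents *)

Section Univariate.
Variable R : realType.
Implicit Types (p q f g : {poly R}).

(** Vanishes at both ends of [-1, 1]: [(quadX * G)^`()] is the form taken below by
    a polynomial whose integral over that interval is zero. *)
Definition quadX : {poly R} := 1 - 'X ^+ 2.

Lemma quadX_factor : quadX = (1 - 'X) * (1 + 'X).
Proof. by rewrite /quadX; ring. Qed.

Lemma size_1BX : size (1 - 'X : {poly R}) = 2.
Proof. by rewrite -opprB size_polyN size_XsubC. Qed.

Lemma size_1DX : size (1 + 'X : {poly R}) = 2.
Proof. by rewrite addrC size_XaddC. Qed.

Lemma size_quadX : size quadX = 3.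
Proof.
rewrite quadX_factor size_mul ?size_1BX ?size_1DX //;
by rewrite -size_poly_eq0 ?size_1BX ?size_1DX.
Qed.

Lemma poly_eq_itv p q : (forall t, -1 < t < 1 -> p.[t] = q.[t]) -> p = q.
Proof.
move=> pq; apply/eqP; rewrite -subr_eq0; apply/negP => /negP pq0.
(* the points 1/2, 1/3, ... are more roots of p - q than its degree allows *)
pose s := [seq (i.+2%:R^-1 : R) | i <- iota 0 (size (p - q))].
suff: (size s < size (p - q)%R)%N by rewrite size_map size_iota ltnn.
apply: max_poly_roots => //; last first.
  rewrite map_inj_uniq ?iota_uniq// => i j /invr_inj/eqP.
  by rewrite eqr_nat => /eqP[].
apply/allP => _ /mapP[i _ ->].
rewrite /root !hornerE pq ?subrr// invf_lt1 ?ltr0n// ltr1n andbT.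
by rewrite (@lt_trans _ _ 0) ?invr_gt0 ?ltr0n// oppr_lt0.
Qed.

Lemma derive1n_horner_itv n (F : R -> R) p :
  (forall t, -1 < t < 1 -> F t = p.[t]) ->
  forall t, -1 < t < 1 -> F^`(n)%classic t = p^`(n).[t].
Proof.
move=> Fp; elim: n => [|n IH] t t11; first by rewrite derive1n0 derivn0 Fp.
rewrite derive1nS derive1E derivnS.
have /near_eq_derive -> : \forall s \near t, F^`(n)%classic s = p^`(n).[s].
  case/andP: t11 => t1 t2.
  apply: (@nbhs_interval _ _ _ (-1)%:E 1%:E); rewrite ?lte_fin// => y.
  by rewrite !lte_fin => y1 y2; apply: IH; rewrite y1.
exact: (@derive_val _ _ _ _ _ _ _ (is_derive_poly _ _)).
Qed.

(** For natural exponents the real powers of Rodrigues' formula are polynomials on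
    the open interval, and an identity there is an identity of polynomials. *)
Lemma jacobi_rodrigues (n a b : nat) : exists2 c : R, c != 0 &
  (1 - 'X) ^+ a * (1 + 'X) ^+ b * jacobi n a%:R b%:R =
  c *: ((1 - 'X) ^+ (n + a) * (1 + 'X) ^+ (n + b))^`(n).
Proof.
exists ((-1) ^+ n / (2 ^+ n * n`!%:R)).
  rewrite mulf_neq0 ?signr_eq0 ?invr_eq0 ?mulf_neq0 ?expf_neq0 ?pnatr_eq0 //.
  by rewrite -lt0n fact_gt0.
apply: poly_eq_itv => t t11.
have bnd s : -1 < s < 1 -> (0 <= 1 - s :> R) && (0 <= 1 + s :> R).
  by move=> /andP[? ?]; apply/andP; split; lra.
have := rodrigues_jacobi n a%:R b%:R t11; case/andP: (bnd _ t11) => t1 t2.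
rewrite !powR_mulrn // => E.
rewrite !(hornerE, horner_exp) E; congr (_ * _); apply: derive1n_horner_itv => // s s11.
case/andP: (bnd _ s11) => s1 s2.
by rewrite -!natrD !powR_mulrn // !(hornerE, horner_exp).
Qed.

Lemma size_derivn_char0 n p : size p^`(n) = (size p - n)%N.
Proof.
elim: n => [|n IH]; first by rewrite derivn0 subn0.
rewrite derivnS subnS -IH; set q := p^`(n).
have [q0|q0] := eqVneq (size q) 0%N.
  by move/eqP: q0; rewrite size_poly_eq0 => /eqP ->; rewrite linear0 size_poly0.
apply/eqP; rewrite eqn_leq; apply/andP; split.
  by rewrite -ltnS prednK ?lt0n// lt_size_deriv// -size_poly_eq0.
case sq : (size q) q0 => [//|[//|k]] _ /=.
have : q^`()`_k != 0.
  rewrite coef_deriv mulrn_eq0 /=; have := lead_coefE q; rewrite sq /= => <-.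
  by rewrite lead_coef_eq0 -size_poly_eq0 sq.
by apply: contraNT; rewrite -leqNgt => /leq_sizeP/(_ k (leqnn _)) ->.
Qed.

(** Compare degrees in Rodrigues' formula. *)
Lemma size_jacobi (n a b : nat) : size (jacobi n a%:R b%:R : {poly R}) = n.+1.
Proof.
have [c c0 E] := jacobi_rodrigues n a b.
have sw (u v : nat) : size ((1 - 'X) ^+ u * (1 + 'X) ^+ v : {poly R}) = (u + v).+1.
  have szX (L : {poly R}) k : size L = 2 -> size (L ^+ k : {poly R}) = k.+1.
    move=> sL; have L0 : L != 0 by rewrite -size_poly_eq0 sL.
    by rewrite -[LHS]prednK ?size_exp ?sL ?mul1n// lt0n size_poly_eq0 expf_neq0.
  by rewrite size_mul -?size_poly_eq0 ?szX ?size_1BX ?size_1DX ?addSn ?addnS.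
have := congr1 (fun p : {poly R} => size p) E.
rewrite size_scale // size_derivn_char0 sw.
have [->|j0] := eqVneq (jacobi n a%:R b%:R : {poly R}) 0.
  by rewrite mulr0 size_poly0 => h; exfalso; lia.
have arith s : s != 0%N -> ((a + b).+1 + s).-1 = ((n + a + (n + b)).+1 - n)%N ->
  s = n.+1 by lia.
rewrite size_mul -?size_poly_eq0 ?sw ?size_poly_eq0 //.
by apply: arith; rewrite size_poly_eq0.
Qed.

(** Integration by parts [n] times: the boundary terms all keep a factor
    [quadX ^+ m.+1], and the last integrand involves [q^`(n) = 0]. *)
Lemma derivn_quadX_orth n m (V q : {poly R}) : (size q <= n)%N ->
  exists G, (quadX ^+ m.+1 * G)^`() = (quadX ^+ (n + m) * V)^`(n) * q.
Proof.
have divL k l (U : {poly R}) : exists G, (quadX ^+ (k + l) * U)^`(k) = quadX ^+ l * G.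
  elim: k l => [|k IH] l; first by exists U; rewrite derivn0.
  have [G EG] := IH l.+1; rewrite derivnS addSnnS EG derivM deriv_exp.
  exists (quadX^`() * G *+ l.+1 + quadX * G^`()).
  by rewrite exprS /=; ring.
elim: n m q => [|n IH] m q sq.
  exists 0; move: sq; rewrite leqn0 size_poly_eq0 => /eqP ->.
  by rewrite !mulr0 linear0.
have sq' : (size q^`() <= n)%N by rewrite -derivn1 size_derivn_char0; lia.
have [G EG] := IH m.+1 _ sq'.
have [H EH] := divL n m.+1 V.
exists (H * q - quadX * G).
rewrite mulrBr mulrA -EH mulrA -exprSr derivB EG derivM addSnnS derivnS.
by ring.
Qed.

(** The orthogonality of the Jacobi polynomials: the integrand has a primitive
    vanishing at both ends of the interval. *)
Lemma jacobi_orth (n a b : nat) q : (size q <= n)%N ->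
  exists G, (quadX * G)^`() = (1 - 'X) ^+ a * (1 + 'X) ^+ b * jacobi n a%:R b%:R * q.
Proof.
move=> sq; have [c c0 ->] := jacobi_rodrigues n a b.
have [G EG] := derivn_quadX_orth 0 ((1 - 'X) ^+ a * (1 + 'X) ^+ b) sq.
exists (c *: G); rewrite -scalerAr linearZ /= -[quadX]expr1 EG addn0.
by rewrite quadX_factor exprMn !exprD scalerAl; congr (_ *: (_)^`(n) * _); ring.
Qed.

Lemma antideriv_Xn e (F h : {poly R}) : F.[0] = 0 -> F^`() = 'X ^+ e * h ->
  exists H, F = 'X ^+ e.+1 * H.
Proof.
move=> F0 dF.
have low i : (i < e.+1)%N -> F`_i = 0.
  case: i => [_|i ie]; first by rewrite -horner_coef0.
  have /eqP := congr1 (fun p : {poly R} => p`_i) dF.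
  by rewrite /= coef_deriv coefXnM -ltnS ie mulrn_eq0 /= => /eqP.
exists (drop_poly e.+1 F).
rewrite -{1}(poly_take_drop e.+1 F) (_ : take_poly _ _ = 0) ?add0r 1?mulrC//.
by apply/polyP => i; rewrite coef_take_poly coef0; case: ifP => // /low.
Qed.

Lemma factor_1BX p : p.[1] = 0 -> exists q, p = (1 - 'X) * q.
Proof.
move=> p1; have /factor_theorem[q ->] : root p 1 by apply/eqP.
by exists (- q); rewrite polyC1; ring.
Qed.

(** Substitute [t = 1 - 2s] in [jacobi_orth], with [q = ((1 - t) / 2) ^+ l].  The
    primitive vanishes at [s = 0] and [s = 1] and its derivative is divisible by
    ['X^(a + l)], so up to a constant it is ['X^(a + l).+1 * (1 - 'X) * H]; the
    identity is the derivative divided by ['X^(a + l)]. *)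
Lemma jacobi_radial (n a b l : nat) : (l < n)%N ->
  exists H, (1 - 'X) ^+ b * (jacobi n a%:R b%:R \Po (1 - 'X *+ 2)) =
    (1 - 'X) * H *+ (a + l).+1 + 'X * ((1 - 'X) * H)^`() :> {poly R}.
Proof.
move=> ln; set T : {poly R} := 1 - 'X *+ 2.
pose q : {poly R} := (2^-1 *: (1 - 'X)) ^+ l.
have sq : (size q <= n)%N.
  apply: leq_trans (size_poly_exp_leq _ _) _.
  by rewrite size_scale ?invr_eq0 ?pnatr_eq0 // size_1BX mul1n.
have [G EG] := jacobi_orth a b sq.
set h := _ * _; pose F := (quadX * G) \Po T.
(* the chain rule contributes - 2, the weight 2 ^+ a and 2 ^+ b *)
pose c : R := - 2 * (2 ^+ a * 2 ^+ b).
have c0 : c != 0 by rewrite !mulf_neq0 ?oppr_eq0 ?expf_neq0 ?pnatr_eq0.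
have dF : F^`() = 'X ^+ (a + l) * (c *: h).
  rewrite deriv_comp EG !rmorphM !rmorphXn /= linearZ /= !rmorphB !rmorphD rmorph1 /=.
  rewrite !comp_polyX.
  have -> : 1 - T = 2%:P * 'X by rewrite polyC_natr /T; ring.
  have -> : 1 + T = 2%:P * (1 - 'X) by rewrite polyC_natr /T; ring.
  have -> : T^`() = (- 2)%:P.
    by rewrite /T derivB derivMn derivX -polyC1 derivC sub0r polyCN polyC_natr.
  rewrite -mul_polyC mulrA -polyCM mulVf ?pnatr_eq0 // mul1r.
  by rewrite -mul_polyC /c !polyCM !exprMn -!polyC_exp /h exprD; ring.
have F0 : F.[0] = 0 by rewrite horner_comp !hornerE /=; ring.
have F1 : F.[1] = 0 by rewrite horner_comp !hornerE /=; ring.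
have [H EH] := antideriv_Xn F0 dF.
have [H1 EH1] : exists q, H = (1 - 'X) * q.
  by apply: factor_1BX; move: F1; rewrite EH !hornerE expr1n mul1r.
exists (c^-1 *: H1); rewrite -scalerAr -EH1 linearZ /= scalerMnr -scalerAr -scalerDr.
apply: (scalerI c0); rewrite scalerA mulfV // scale1r.
apply: (@mulfI _ ('X ^+ (a + l))); first by rewrite expf_neq0 ?polyX_eq0.
by rewrite -dF EH derivM derivXn /= exprSr; ring.
Qed.

End Univariate.

(** * Polynomials in s and d, and the orthogonality relation *)

Section Collapsed.
Variables (R : realType) (A : comAlgType R) (S D : A).
Implicit Types (f g : {poly R}) (x y : A).

(** [S ^+ m * g (D / S)] for [g] of size at most [m.+1], without the division. *)
Definition homogenize m g : A := \sum_(i < m.+1) g`_i *: (D ^+ i * S ^+ (m - i)).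

Lemma homogenize_linear m : linear (homogenize m).
Proof.
move=> a p q; rewrite /homogenize scaler_sumr -big_split /=; apply: eq_bigr => i _.
by rewrite coefD coefZ scalerDl scalerA.
Qed.
HB.instance Definition _ m :=
  GRing.isLinear.Build R {poly R} A *:%R (homogenize m) (homogenize_linear m).

Lemma homogenizeXM m g : homogenize m.+1 ('X * g) = D * homogenize m g.
Proof.
rewrite /homogenize big_ord_recl coefXM scale0r add0r mulr_sumr.
by apply: eq_bigr => i _; rewrite coefXM /= subSS -scalerAr mulrA -exprS.
Qed.

Lemma homogenizeXnM j m g : homogenize (m + j) ('X^j * g) = D ^+ j * homogenize m g.
Proof.
elim: j => [|j IH]; first by rewrite !mul1r addn0.
by rewrite addnS exprS -mulrA homogenizeXM IH mulrA -exprS.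
Qed.

Lemma homogenize_widen m g : (size g <= m.+1)%N -> homogenize m.+1 g = S * homogenize m g.
Proof.
move=> sg; rewrite /homogenize big_ord_recr /= nth_default // scale0r addr0 mulr_sumr.
apply: eq_bigr => i _; rewrite -scalerAr mulrCA -exprS subSn //.
by rewrite -ltnS.
Qed.

Lemma homogenize_quadM m g : (size g <= m.+1)%N ->
  homogenize m.+2 (quadX R * g) = (S ^+ 2 - D ^+ 2) * homogenize m g.
Proof.
move=> sg; rewrite /quadX mulrBl mul1r linearB /= expr2 -mulrA !homogenizeXM.
by rewrite (homogenize_widen (leqW sg)) (homogenize_widen sg); ring.
Qed.

Definition derivation (d : A -> A) := forall x y, d (x * y) = d x * y + x * d y.

Section Derivation.
Variable d : {linear A -> A}.
Hypothesis dM : derivation d.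

Lemma derivation1 : d 1 = 0.
Proof.
have := dM 1 1; rewrite !mul1r mulr1 => /eqP.
by rewrite -subr_eq0 opprD addNKr oppr_eq0 => /eqP.
Qed.

Lemma derivationX n x : d (x ^+ n) = (d x * x ^+ n.-1) *+ n.
Proof.
elim: n => [|n IH]; first by rewrite derivation1 mulr0n.
by rewrite exprS dM IH; case: n {IH} => [|n] /=; rewrite ?exprS; ring.
Qed.

Lemma derivation_horner f x : d (horner_alg x f) = horner_alg x f^`() * d x.
Proof.
elim/poly_ind: f => [|f c IH]; first by rewrite deriv0 !linear0 mul0r.
rewrite derivMXaddC !rmorphD !rmorphM /= !horner_algX horner_algC linearD /= dM IH.
by rewrite linearZ /= derivation1 scaler0; ring.
Qed.

End Derivation.

(** The polynomial [P_{k,n}^{(2,2,2)}] as an element of the algebra of [S] and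
    [D]. *)
Definition jacobi_alg (k n : nat) : A :=
  horner_alg S (jacobi (n - k) (2 * k%:R + 2 + 2 + 1) 2 \Po (1 - 'X *+ 2)) *
  homogenize k (jacobi k 2 2).

(** [I] stands for integration over the triangle, [ds] and [dd] for the partial
    derivatives in [S] and [D], and [B] for four times the bubble; [Ids] and [Idd]
    are the divergence theorem for fields vanishing on the boundary. *)
Section Orthogonality.
Variables (ds dd : {linear A -> A}) (I : {linear A -> R^o}).
Hypothesis (dsM : derivation ds) (ddM : derivation dd).
Hypothesis (dsS : ds S = 1) (dsD : ds D = 0) (ddS : dd S = 0) (ddD : dd D = 1).
Let B := (1 - S) * (S ^+ 2 - D ^+ 2).
Hypothesis (Ids : forall x, I (ds (B * x)) = 0) (Idd : forall x, I (dd (B * x)) = 0).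

Lemma dd_homogenize m g : dd (homogenize m.+1 g) = homogenize m g^`().
Proof.
rewrite /homogenize big_ord_recl linearD linear_sum /= !linearZ /= mul1r derivationX //.
rewrite ddS mul0r mul0rn scaler0 add0r; apply: eq_bigr => i _.
rewrite linearZ /= ddM !derivationX // ddD ddS coef_deriv subSS /=.
by rewrite mul1r mul0r mul0rn mulr0 addr0 mulrnAl -scalerMnr scalerMnl.
Qed.

Lemma euler_homogenize m g :
  S * ds (homogenize m g) + D * dd (homogenize m g) = homogenize m g *+ m.
Proof.
have pw n x : x * (x ^+ n.-1) *+ n = x ^+ n *+ n.
  by case: n => [|n]; rewrite ?mulr0n // -exprS.
rewrite /homogenize !linear_sum !mulr_sumr -big_split /= -sumrMnl; apply: eq_bigr => i _.
rewrite !linearZ /= dsM ddM !derivationX // dsS dsD ddS ddD.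
rewrite !mul1r !mul0r !mul0rn !mul0r !mulr0 addr0 add0r.
rewrite -!scalerAr -scalerDr scalerMnr; congr (_ *: _).
rewrite mulrCA [S * (_ *+ _)]mulrnAr pw mulrA [D * (_ *+ _)]mulrnAr pw.
by rewrite mulrnAr mulrnAl -mulrnDr subnK // -ltnS.
Qed.

(** For fixed [S], integrating in [D] gives zero, as [quadX * G] vanishes at the
    ends: the integrand is the [dd]-derivative of a multiple of [B]. *)
Lemma functional_homogenize_deriv m (f1 G : {poly R}) : (size G <= m.+1)%N ->
  I (horner_alg S ((1 - 'X) * f1) * homogenize m.+1 (quadX R * G)^`()) = 0.
Proof.
move=> sG; rewrite -(Idd (horner_alg S f1 * homogenize m G)); congr (I _).
have -> : B * (horner_alg S f1 * homogenize m G) =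
    horner_alg S ((1 - 'X) * f1) * homogenize m.+2 (quadX R * G).
  by rewrite homogenize_quadM // rmorphM rmorphB rmorph1 /= horner_algX /B; ring.
by rewrite ddM dd_homogenize derivation_horner // ddS mulr0 mul0r add0r.
Qed.

(** The integrand is the divergence of the radial field [Phi(S) h (S, D)], with [h]
    homogeneous of degree [m.+2]: by Euler's identity this divergence is
    [(S Phi'(S) + m.+4 Phi(S)) h], two of the [m.+4] coming from the divergence of
    [(S, D)]. *)
Lemma functional_radial m (f1 G : {poly R}) : (size G <= m.+1)%N ->
  let Phi := (1 - 'X) * f1 in
  I (horner_alg S (Phi *+ m.+4 + 'X * Phi^`()) * homogenize m.+2 (quadX R * G)) = 0.
Proof.
move=> sG Phi; set p := horner_alg S f1 * homogenize m G.
have BE : horner_alg S Phi * homogenize m.+2 (quadX R * G) = B * p.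
  by rewrite homogenize_quadM // rmorphM rmorphB rmorph1 /= horner_algX /B /p; ring.
rewrite [LHS](_ : _ = I (ds (B * (S * p)) + dd (B * (D * p)))).
  by rewrite linearD /= Ids Idd addr0.
rewrite (mulrCA B S) (mulrCA B D) -BE; congr (I _).
set h := homogenize _ _; rewrite 2!dsM 2!ddM dsS ddD !derivation_horner // dsS ddS.
have := euler_homogenize m.+2 (quadX R * G); rewrite -/h => E.
rewrite rmorphD rmorphM rmorphMn /= horner_algX.
transitivity (horner_alg S Phi * (h *+ m.+2) + horner_alg S Phi * h *+ 2 +
              S * horner_alg S Phi^`() * h).
  by rewrite -mulrnAr -mulrDr -mulrnDr addn2 mulrDl mulrnAr mulrnAl.
by rewrite -E; ring.
Qed.

(** The inner Jacobi polynomial [jacobi k 2 2] is orthogonal to ['X^j] when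
    [j < k]; otherwise [i + j - k < n - k] and the outer one is orthogonal to
    ['X^(i + j - k)]. *)
Lemma jacobi_alg_orth k n i j : (k <= n)%N -> (i + j < n)%N ->
  I (B ^+ 2 * jacobi_alg k n * (S ^+ i * D ^+ j)) = 0.
Proof.
move=> kn ijn; rewrite /jacobi_alg.
have -> : 2 * k%:R + 2 + 2 + 1 = (2 * k + 5)%N%:R :> R by rewrite natrD natrM; ring.
set J := _ \Po _; set Jk := jacobi k 2 2.
have sJk : size Jk = k.+1 := size_jacobi R k 2 2.
have sXJ : (size ('X^j * Jk)%R <= (k + j).+1)%N.
  by apply: leq_trans (size_polyMleq _ _) _; rewrite size_polyXn sJk; lia.
have sQ (p : {poly R}) s : (size p <= s.+1)%N -> (size (quadX R * p)%R <= s.+3)%N.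
  by move=> sp; apply: leq_trans (size_polyMleq _ _) _; rewrite size_quadX; lia.
rewrite [X in I X](_ : _ = horner_alg S ((1 - 'X) ^+ 2 * ('X^i * J)) *
    homogenize (k + j).+4 (quadX R * (quadX R * ('X^j * Jk)))); last first.
  rewrite homogenize_quadM ?sQ // homogenize_quadM // homogenizeXnM.
  by rewrite !rmorphM !rmorphXn rmorphB rmorph1 /= horner_algX /B; ring.
have [jk|kj] := ltnP j k.
- have sXj : (size ('X^j : {poly R}) <= k)%N by rewrite size_polyXn.
  have [G EG] := jacobi_orth 2 2 sXj.
  have <- : (quadX R * G)^`() = quadX R * (quadX R * ('X^j * Jk)).
    by rewrite EG quadX_factor -/Jk; ring.
  rewrite expr2 -mulrA; apply: functional_homogenize_deriv.
  (* the size of G is read off from that of the derivative of quadX * G *)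
  have := sQ _ _ (sQ _ _ sXJ); rewrite (_ : _ * (_ * _) = (quadX R * G)^`()); last first.
    by rewrite EG quadX_factor -/Jk; ring.
  rewrite -derivn1 size_derivn_char0.
  have [->|G0] := eqVneq G 0; first by rewrite size_poly0.
  by rewrite size_mul // -?size_poly_eq0 size_quadX //; lia.
- have ln : (i + j - k < n - k)%N by lia.
  have [H EH] := jacobi_radial R (2 * k + 5) 2 ln.
  rewrite mulrCA EH [X in horner_alg S X](_ : _ =
     ((1 - 'X) * ('X^i * H)) *+ (k + j).+2.+4 + 'X * ((1 - 'X) * ('X^i * H))^`()).
    by apply: functional_radial; apply: sQ.
  (* the factor 'X^i is moved from the weight into Phi *)
  have -> : ((2 * k + 5 + (i + j - k)).+1 = (k + j).+2.+4 + i)%N by lia.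
  rewrite mulrnDr [(1 - _) * (_ * _)]mulrCA [in RHS]derivM derivXn.
  set P := (1 - 'X) * H; case: (i) => [|e] /=; first by rewrite !mulr0n; ring.
  by rewrite exprS; ring.
Qed.

End Orthogonality.
End Collapsed.

(** * Polynomials in two variables *)

Section TrianglePolynomials.
Variable R : realType.
Local Notation A := (mpoly 2 R).
Implicit Types (p q : A) (x v : R * R).

Definition coordX (i : 'I_2) : A := mpolyX R (mnm1 i).
Definition mev x : A -> R := meval (fun i : 'I_2 => if i == ord0 then x.1 else x.2).

HB.instance Definition _ x := GRing.LRMorphism.copy (mev x) (meval _).

Lemma mev_coordX x i : mev x (coordX i) = if i == ord0 then x.1 else x.2.
Proof. exact: mevalXU. Qed.

Lemma mev_horner_alg x p (f : {poly R}) : mev x (horner_alg p f) = f.[mev x p].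
Proof.
elim/poly_ind: f => [|f c IH]; first by rewrite linear0 rmorph0 horner0.
by rewrite !rmorphD !rmorphM /= horner_algX horner_algC IH linearZ /= rmorph1 !hornerE.
Qed.

Lemma monomialE (m : multinom 2) :
  mpolyX R m = coordX ord0 ^+ m ord0 * coordX ord_max ^+ m ord_max.
Proof.
rewrite mpolyXE_id big_ord_recl big_ord1 (_ : lift _ _ = ord_max) //.
exact: val_inj.
Qed.

Lemma mpoly2_ind (P : A -> Prop) :
  (forall c : R, P c%:A) -> (forall i p, P p -> P (coordX i * p)) ->
  (forall p q, P p -> P q -> P (p + q)) -> forall p, P p.
Proof.
move=> PC PX PD p; rewrite (mpolyE p).
elim/big_ind: _ => [||m _]; [by rewrite -(scale0r 1) | exact: PD |].
rewrite monomialE -[_ * _]mulr1 scalerAr -mulrA.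
elim: (m ord0) => [|a IH]; last by rewrite exprS -mulrA; exact: PX.
rewrite mul1r; elim: (m ord_max) => [|b IH]; last by rewrite exprS -mulrA; exact: PX.
by rewrite mul1r; exact: PC.
Qed.

Definition dirder v p : A := v.1 *: mderiv ord0 p + v.2 *: mderiv ord_max p.

Lemma dirder_linear v : linear (dirder v).
Proof.
move=> a p q; rewrite /dirder !mderiv_is_linear !scalerDr !scalerA.
by rewrite ![a * _]mulrC; rewrite addrACA.
Qed.
HB.instance Definition _ v :=
  GRing.isLinear.Build R A A *:%R (dirder v) (dirder_linear v).

Lemma dirderM v : derivation (dirder v).
Proof.
move=> p q; rewrite /dirder !mderivM !scalerDr !mulrDl !mulrDr -!scalerAl -!scalerAr.
by rewrite addrACA.
Qed.

Definition affine (a b c : R) : A := a *: coordX ord0 + b *: coordX ord_max + c%:A.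

Lemma mev_affine x a b c : mev x (affine a b c) = a * x.1 + b * x.2 + c.
Proof. by rewrite /affine !rmorphD /= !linearZ /= !mev_coordX rmorph1 mulr1. Qed.

Lemma affineD a b c a' b' c' :
  affine a b c + affine a' b' c' = affine (a + a') (b + b') (c + c').
Proof. by rewrite /affine !scalerDl addrACA (addrACA (a *: _)). Qed.

Lemma affineZ k a b c : k *: affine a b c = affine (k * a) (k * b) (k * c).
Proof. by rewrite /affine !scalerDr !scalerA. Qed.

Lemma affineN a b c : - affine a b c = affine (- a) (- b) (- c).
Proof. by rewrite -scaleN1r affineZ !mulN1r. Qed.

Lemma dirder_affine v a b c : dirder v (affine a b c) = (v.1 * a + v.2 * b)%:A.
Proof.
have dX v' i : dirder v' (coordX i) = (if i == ord0 then v'.1 else v'.2)%:A.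
  have U j : mnm_sub (mnm1 j) (mnm1 j) = mnm0 :> multinom 2.
    by apply/mnmP => k; rewrite mnmBE subnn mnm0E.
  rewrite /dirder /coordX !mderivX !mnm1E.
  case: (unliftP ord0 i) => [j ->|->]; rewrite ?ord1 /=.
    rewrite (_ : lift _ _ = ord_max); last exact: val_inj.
    by rewrite scale0r scaler0 add0r scale1r U mpolyX0.
  by rewrite scale0r scaler0 addr0 scale1r U mpolyX0.
rewrite /affine !linearD !linearZ /= !dX /= (derivation1 (@dirderM v)) scaler0 addr0.
by rewrite !scalerA -scalerDl ![_ * v.1]mulrC ![_ * v.2]mulrC.
Qed.

End TrianglePolynomials.

(** * Barycentric coordinates as polynomials *)

Section TriangleSpan.
Variables (R : realType) (K : triangle R).
Local Notation A := (mpoly 2 R).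
Implicit Types (p q : A) (x v : R * R).

Let v1 := vtx1 K.
Let v2 := vtx2 K.
Let v3 := vtx3 K.
Let area := sarea v1 v2 v3.

Definition bary1 : A := affine ((v2.2 - v3.2) / area) ((v3.1 - v2.1) / area)
  ((v2.1 * v3.2 - v2.2 * v3.1) / area).
Definition bary2 : A := affine ((v3.2 - v1.2) / area) ((v1.1 - v3.1) / area)
  ((v3.1 * v1.2 - v3.2 * v1.1) / area).
Definition bary3 : A := affine ((v1.2 - v2.2) / area) ((v2.1 - v1.1) / area)
  ((v1.1 * v2.2 - v1.2 * v2.1) / area).

Lemma mev_bary1 x : mev x bary1 = lambda1 K x.
Proof.
rewrite mev_affine /lambda1 -/v1 -/v2 -/v3 -/area /sarea; ring.
Qed.
Lemma mev_bary2 x : mev x bary2 = lambda2 K x.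
Proof.
rewrite mev_affine /lambda2 -/v1 -/v2 -/v3 -/area /sarea; ring.
Qed.
Lemma mev_bary3 x : mev x bary3 = lambda3 K x.
Proof.
rewrite mev_affine /lambda3 -/v1 -/v2 -/v3 -/area /sarea; ring.
Qed.

Definition baryS : A := bary2 + bary3.
Definition baryD : A := bary2 - bary3.
(** The directions dual to the coordinates [baryS] and [baryD]: derivation along
    them is partial derivation in these coordinates. *)
Definition dirS : R * R :=
  ((v2.1 + v3.1) / 2 - v1.1, (v2.2 + v3.2) / 2 - v1.2).
Definition dirD : R * R := ((v2.1 - v3.1) / 2, (v2.2 - v3.2) / 2).

Lemma area_neq0 : area != 0.
Proof. exact: vtx_nondegenerate. Qed.

Let affine_eq (a b c a' b' c' : R) : a = a' -> b = b' -> c = c' ->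
  affine a b c = affine a' b' c'.
Proof. by move=> -> -> ->. Qed.

Lemma affine1 : affine 0 0 1 = 1 :> A.
Proof. by rewrite /affine !scale0r !add0r scale1r. Qed.

Lemma bary1E : bary1 = 1 - baryS.
Proof.
move: area_neq0; rewrite /baryS /bary1 /bary2 /bary3 /area /sarea => h.
by rewrite -affine1 affineD affineN affineD; apply: affine_eq; field.
Qed.

Lemma dirS_S : dirder dirS baryS = 1.
Proof.
move: area_neq0; rewrite /baryS /bary2 /bary3 /area /sarea => h.
rewrite affineD dirder_affine -[RHS]scale1r /dirS /=; congr (_ *: _).
by field.
Qed.
Lemma dirS_D : dirder dirS baryD = 0.
Proof.
move: area_neq0; rewrite /baryD /bary2 /bary3 /area /sarea => h.
rewrite affineN affineD dirder_affine -[RHS](scale0r 1) /dirS /=; congr (_ *: _).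
by field.
Qed.
Lemma dirD_S : dirder dirD baryS = 0.
Proof.
move: area_neq0; rewrite /baryS /bary2 /bary3 /area /sarea => h.
rewrite affineD dirder_affine -[RHS](scale0r 1) /dirD /=; congr (_ *: _).
by field.
Qed.
Lemma dirD_D : dirder dirD baryD = 1.
Proof.
move: area_neq0; rewrite /baryD /bary2 /bary3 /area /sarea => h.
rewrite affineN affineD dirder_affine -[RHS]scale1r /dirD /=; congr (_ *: _).
by field.
Qed.

Lemma coordX_baryE i : exists a b c : R, coordX R i = a *: baryS + b *: baryD + c%:A.
Proof.
have E (j : bool) : exists a b c : R,
    affine (~~ j)%:R j%:R 0 = a *: baryS + b *: baryD + c *: affine 0 0 1.
  pose w (v : R * R) := if j then v.2 else v.1.
  exists ((w v2 + w v3) / 2 - w v1), ((w v2 - w v3) / 2), (w v1).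
  move: area_neq0; rewrite /baryS /baryD /bary2 /bary3 /area /sarea => h.
  rewrite affineN !affineD !affineZ !affineD /w.
  by case: j {w} => /=; apply: affine_eq; field.
have [a [b [c]]] := E (i != ord0); rewrite affine1 => abc.
exists a, b, c; rewrite -abc /affine scale0r addr0; case: (unliftP ord0 i) => [j|] ->.
  by rewrite ord1 (_ : lift _ _ = ord_max) /= ?scale0r ?add0r ?scale1r //; exact: val_inj.
by rewrite /= scale0r addr0 scale1r.
Qed.

Lemma msize_scale_le (c : R) p n : (msize p <= n)%N -> (msize (c *: p) <= n)%N.
Proof. by apply: leq_trans; exact: msizeZ_le. Qed.

Lemma msize_add_le p q n :
  (msize p <= n)%N -> (msize q <= n)%N -> (msize (p + q)%R <= n)%N.
Proof. by move=> hp hq; apply: leq_trans (msizeD_le _ _) _; rewrite geq_max hp. Qed.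

Lemma msize_mul_le p q m n : (msize p <= m)%N -> (msize q <= n.+1)%N ->
  (msize (p * q)%R <= m + n)%N.
Proof.
have [->|p0] := eqVneq p 0; first by rewrite mul0r mmeasure0.
have [->|q0] := eqVneq q 0; first by rewrite mulr0 mmeasure0.
rewrite msizeM // => sp sq.
by rewrite -subn1 leq_subLR add1n -addnS leq_add.
Qed.

Lemma msize_affine (a b c : R) : (msize (affine a b c) <= 2)%N.
Proof.
rewrite /affine /coordX; apply: msize_add_le; first apply: msize_add_le;
  apply: msize_scale_le; by rewrite ?msizeX ?mdeg1 // msize1.
Qed.

Lemma msize_exp p n : (msize p <= 2)%N -> (msize (p ^+ n)%R <= n.+1)%N.
Proof.
move=> sp; elim: n => [|n IH]; first by rewrite msize1.
by rewrite exprSr -[n.+2]addn1 msize_mul_le.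
Qed.

Lemma msize_baryS : (msize baryS <= 2)%N.
Proof. by apply: msize_add_le; exact: msize_affine. Qed.
Lemma msize_baryD : (msize baryD <= 2)%N.
Proof. by apply: msize_add_le; rewrite ?msizeN; exact: msize_affine. Qed.

Lemma msize_SD i j : (msize (baryS ^+ i * baryD ^+ j)%R <= (i + j).+1)%N.
Proof.
by rewrite -addSn msize_mul_le ?msize_exp ?msize_baryS ?msize_baryD.
Qed.

(** The monomials in [baryS] and [baryD] of degree at most [n] span the polynomials
    of degree at most [n], stated as an induction principle for linear subspaces:
    the cartesian coordinates of a monomial are exchanged one at a time for affine
    expressions in [baryS] and [baryD]. *)
Lemma baryS_baryD_ind (P : A -> Prop) n :
  P 0 -> (forall (a : R) p q, P p -> P q -> P (a *: p + q)) ->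
  (forall i j, (i + j <= n)%N -> P (baryS ^+ i * baryD ^+ j)) ->
  forall p, (msize p <= n.+1)%N -> P p.
Proof.
move=> P0 PL Pm p sp.
have PX a b : forall i j, (i + j + a + b <= n)%N ->
    P (coordX R ord0 ^+ a * coordX R ord_max ^+ b * (baryS ^+ i * baryD ^+ j)).
  elim: a => [|a IHa].
    elim: b => [|b IHb] i j h; first by rewrite !mul1r; apply: Pm; lia.
    have [u [v [c E]]] := coordX_baryE ord_max.
    rewrite mul1r exprSr [X in _ * X * _]E.
    rewrite [X in P X](_ : _ =
      u *: (1 * coordX R ord_max ^+ b * (baryS ^+ i.+1 * baryD ^+ j)) +
      (v *: (1 * coordX R ord_max ^+ b * (baryS ^+ i * baryD ^+ j.+1)) +
      (c *: (1 * coordX R ord_max ^+ b * (baryS ^+ i * baryD ^+ j)) + 0))).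
      by do 3 (apply: (PL); first by apply: IHb; lia).
    rewrite -![_ *: (_ * _)]mulr_algl !exprS -[u *: _]mulr_algl -[v *: _]mulr_algl; ring.
  move=> i j h.
  have [u [v [c E]]] := coordX_baryE ord0.
  rewrite exprSr [X in _ * X * _ * _]E; set Y := _ ^+ b.
  rewrite [X in P X](_ : _ =
    u *: (coordX R ord0 ^+ a * Y * (baryS ^+ i.+1 * baryD ^+ j)) +
    (v *: (coordX R ord0 ^+ a * Y * (baryS ^+ i * baryD ^+ j.+1)) +
    (c *: (coordX R ord0 ^+ a * Y * (baryS ^+ i * baryD ^+ j)) + 0))).
    by do 3 (apply: (PL); first by apply: IHa; lia).
  rewrite -![_ *: (_ * _)]mulr_algl !exprS -[u *: _]mulr_algl -[v *: _]mulr_algl; ring.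
rewrite (mpolyE p) big_seq.
elim/big_rec: _ => // m q mp Pq; apply: PL => //.
have := leq_trans (msize_mdeg_lt mp) sp.
rewrite mdegE big_ord_recl big_ord1 (_ : lift _ _ = ord_max) ?ltnS; last exact: val_inj.
move=> h; rewrite monomialE -[_ * _]mulr1 -[1]mulr1 -{1}(expr0 baryS) -(expr0 baryD).
exact: PX.
Qed.

End TriangleSpan.

(** * Jacobi polynomials and polynomials of lower degree span *)

Section JacobiSpan.
Variables (R : realType) (K : triangle R).
Local Notation A := (mpoly 2 R).
Implicit Types (p q : A).
Local Notation S := (baryS K).
Local Notation D := (baryD K).
Local Notation U := (jacobi_alg S D).

Lemma msize_sum_le (I : Type) (r : seq I) (P : pred I) (F : I -> A) n :
  (forall i, P i -> (msize (F i) <= n)%N) ->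
  (msize (\sum_(i <- r | P i) F i)%R <= n)%N.
Proof.
move=> h; elim/big_ind: _ => //; first by rewrite mmeasure0.
by move=> p q; exact: msize_add_le.
Qed.

Lemma msize_homogenize m (g : {poly R}) : (msize (homogenize S D m g) <= m.+1)%N.
Proof.
apply: msize_sum_le => i _; apply: msize_scale_le; rewrite mulrC.
by rewrite (leq_trans (msize_SD _ _ _)) // subnK // -ltnS.
Qed.

Lemma horner_alg_top e (f : {poly R}) : (size f <= e.+1)%N ->
  exists2 low : A, (msize low <= e)%N & horner_alg S f = f`_e *: S ^+ e + low.
Proof.
move=> sf; exists (\sum_(i < e) f`_i *: S ^+ i).
  apply: msize_sum_le => i _; apply: msize_scale_le.
  exact: leq_trans (msize_exp _ (msize_baryS K)) _.
rewrite /horner_alg /horner_morph (@horner_coef_wide _ e.+1); last first.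
  exact: leq_trans (size_poly _ _) sf.
rewrite big_ord_recr /= addrC coef_map /= mulr_algl; congr (_ + _).
by apply: eq_bigr => i _; rewrite coef_map /= mulr_algl.
Qed.

(** Both Jacobi factors have full degree, so modulo lower degree the family is
    triangular, with nonzero diagonal, in the monomials of degree [n]. *)
Lemma jacobi_alg_top k n : (k <= n)%N ->
  exists (a : R) (b : 'I_k -> R) (low : A), [/\ a != 0, (msize low <= n)%N &
   U k n = a *: (S ^+ (n - k) * D ^+ k) +
     (\sum_(i < k) b i *: (S ^+ (n - i) * D ^+ i) + low)].
Proof.
move=> kn; rewrite /jacobi_alg.
have -> : 2 * k%:R + 2 + 2 + 1 = (2 * k + 5)%N%:R :> R by rewrite natrD natrM; ring.
set J := _ \Po _; set Jk := jacobi k 2 2.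
have sJ : size J = (n - k).+1.
  rewrite size_comp_poly2 ?size_jacobi //.
  have -> : 1 - 'X *+ 2 = (- 2)%:P * 'X + 1%:P :> {poly R}.
    by rewrite polyCN polyC_natr polyC1; ring.
  have n2 : - 2 != 0 :> R by rewrite oppr_eq0 pnatr_eq0.
  by rewrite size_MXaddC polyC_eq0 size_polyC (negbTE n2).
have sJk : size Jk = k.+1 := size_jacobi R k 2 2.
have [|low slow ->] := @horner_alg_top (n - k) J; first by rewrite sJ.
set a := J`_(n - k); have a0 : a != 0.
  rewrite /a -[(n - k)%N]/((n - k).+1.-1) -sJ -lead_coefE.
  by rewrite lead_coef_eq0 -size_poly_eq0 sJ.
have b0 : Jk`_k != 0.
  by rewrite -[k in _`_k]/(k.+1.-1) -sJk -lead_coefE lead_coef_eq0 -size_poly_eq0 sJk.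
exists (a * Jk`_k), (fun i => a * Jk`_i), (low * homogenize S D k Jk); split.
- by rewrite mulf_neq0.
- rewrite -[n in (_ <= n)%N](subnK kn).
  exact: (msize_mul_le slow (msize_homogenize _ _)).
- rewrite mulrDl addrA; congr (_ + _).
  rewrite /homogenize big_ord_recr /= subnn mulr1 addrC mulrDr; congr (_ + _).
    by rewrite -scalerAl -scalerAr scalerA.
  rewrite mulr_sumr; apply: eq_bigr => i _.
  rewrite -scalerAl -scalerAr scalerA; congr (_ *: _).
  rewrite mulrCA -exprD mulrC; congr (_ ^+ _ * _).
  by have := ltn_ord i; lia.
Qed.

(** Invert the triangular system of [jacobi_alg_top] by induction on [k]. *)
Lemma jacobi_alg_span n p : (msize p <= n.+1)%N ->
  exists (c : 'I_n.+1 -> R) (w : A),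
    (msize w <= n)%N /\ p = \sum_(k < n.+1) c k *: U k n + w.
Proof.
pose P (p : A) := exists (c : 'I_n.+1 -> R) (w : A),
    (msize w <= n)%N /\ p = \sum_(k < n.+1) c k *: U k n + w.
have Plow w : (msize w <= n)%N -> P w.
  move=> sw; exists (fun=> 0), w; split=> //.
  by rewrite big1 ?add0r // => i _; rewrite scale0r.
have P0 : P 0 by apply: Plow; rewrite mmeasure0.
have PL (a : R) p1 p2 : P p1 -> P p2 -> P (a *: p1 + p2).
  move=> [c [w [sw ->]]] [d [z [sz ->]]].
  exists (fun i => a * c i + d i), (a *: w + z); split.
    by apply: msize_add_le => //; exact: msize_scale_le.
  rewrite scalerDr addrACA; congr (_ + _).
  rewrite scaler_sumr -big_split /=; apply: eq_bigr => i _.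
  by rewrite scalerDl scalerA.
have PU (k : 'I_n.+1) : P (U k n).
  exists (fun i => (i == k)%:R), 0; split; first by rewrite mmeasure0.
  rewrite (bigD1 k) //= eqxx scale1r big1 ?addr0 // => i /negbTE ->.
  by rewrite scale0r.
have Ptop k : (k <= n)%N -> P (S ^+ (n - k) * D ^+ k).
  elim/ltn_ind: k => k IH kn.
  have [a [b [low [a0 slow E]]]] := jacobi_alg_top kn.
  have -> : S ^+ (n - k) * D ^+ k = a^-1 *: U k n +
     (- a^-1 *: (\sum_(i < k) b i *: (S ^+ (n - i) * D ^+ i)) + (- a^-1 *: low + 0)).
    rewrite E addr0 -scalerDr scaleNr scalerDr scalerA mulVf // scale1r.
    by rewrite addrK.
  apply: (PL); first exact: (PU (Ordinal (kn : k < n.+1)%N)).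
  apply: (PL); last by apply: (PL) => //; exact: Plow.
  elim/big_rec: _ => // i q _ Pq; apply: (PL) => //; apply: (IH) => //.
  by rewrite (leq_trans _ kn) // ltnW.
move=> sp; apply: (@baryS_baryD_ind R K P n) => // i j.
rewrite leq_eqVlt => /orP[/eqP ij|ij].
  by have := Ptop j; rewrite -ij addnK; apply; rewrite leq_addl.
by apply: Plow; apply: leq_trans (msize_SD _ _ _) _.
Qed.

Lemma msize_jacobi_alg k n : (k <= n)%N -> (msize (U k n) <= n.+1)%N.
Proof.
move=> kn; have [a [b [low [_ slow ->]]]] := jacobi_alg_top kn.
apply: msize_add_le.
  by apply: msize_scale_le; rewrite (leq_trans (msize_SD _ _ _)) // subnK.
apply: msize_add_le; last exact: leqW.
apply: msize_sum_le => i _; apply: msize_scale_le.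
by rewrite (leq_trans (msize_SD _ _ _)) // subnK // (leq_trans _ kn) // ltnW.
Qed.

End JacobiSpan.

(** * Slices of an intersection of half-planes *)

Section Slices.
Variable R : realType.
Implicit Types (s : seq (R * R)) (a b l u x : R).

(** Adding the constraints one at a time, the segment either stays as it is, or
    becomes empty, or gets the zero of the new affine function as an end point. *)
Lemma affine_slice s a b : a <= b ->
  let C := [set x | a <= x <= b /\ all (fun h => 0 <= h.1 * x + h.2) s] in
  let van x := has (fun h => h.1 * x + h.2 == 0) s in
  C = set0 \/ exists l u,
    [/\ l <= u, C = [set` `[l, u]], l = a \/ van l & u = b \/ van u].
Proof.
move=> ab; elim: s => [|[k c] s IH] C van.
  right; exists a, b; split; [by [] | | by left | by left].
  by apply/seteqP; split => x /=; rewrite in_itv /=; [case | move=> ?; split].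
case: IH => [C0|[l [u [lu CE vl vu]]]].
  by left; rewrite -subset0 -C0 => x [/= h /andP[_ ?]]; split.
have CI : C = [set` `[l, u]] `&` [set x | 0 <= k * x + c].
  rewrite -CE; apply/seteqP; split => x /=; first by case=> h /andP[? ?].
  by case=> -[h1 h2] h3; split=> //; apply/andP.
have vl' : l = a \/ van l by case: vl => h; [left | right; rewrite /van /= h orbT].
have vu' : u = b \/ van u by case: vu => h; [left | right; rewrite /van /= h orbT].
have vr x : k * x + c = 0 -> van x by move=> h; rewrite /van /= h eqxx.
have root : k != 0 -> k * (- c / k) + c = 0 by move=> k0; field.
have [k0|k0|k0] := ltgtP k 0.
- have rE := root (ltr0_neq0 k0); set r := - c / k in rE.
  have fac x : k * x + c = k * (x - r) by rewrite -[LHS]subr0 -rE; ring.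
  have cr x : (0 <= k * x + c) = (x <= r).
    by rewrite fac nmulr_rge0 // subr_le0.
  have [rl|lr] := ltP r l.
    left; rewrite CI -subset0 => x [/=]; rewrite in_itv /= cr => /andP[h1 _] h2.
    by have := lt_le_trans rl (le_trans h1 h2); rewrite ltxx.
  right; have [ur|ru] := leP u r.
    exists l, u; split => //; rewrite CI; apply/seteqP; split => x /= => [[]//|h].
    split=> //; rewrite cr; move: h; rewrite in_itv /= => /andP[_ h].
    exact: le_trans ur.
  exists l, r; split => //; last by right; exact: vr.
  rewrite CI; apply/seteqP; split => x /=; rewrite !in_itv /= cr.
    by case=> /andP[-> _].
  by move=> /andP[-> h]; rewrite h (le_trans h (ltW ru)).
- have rE := root (lt0r_neq0 k0); set r := - c / k in rE.
  have fac x : k * x + c = k * (x - r) by rewrite -[LHS]subr0 -rE; ring.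
  have cr x : (0 <= k * x + c) = (r <= x).
    by rewrite fac pmulr_rge0 // subr_ge0.
  have [ur|ru] := ltP u r.
    left; rewrite CI -subset0 => x [/=]; rewrite in_itv /= cr => /andP[_ h1] h2.
    by have := lt_le_trans ur (le_trans h2 h1); rewrite ltxx.
  right; have [rl|lr] := leP r l.
    exists l, u; split => //; rewrite CI; apply/seteqP; split => x /= => [[]//|h].
    split=> //; rewrite cr; move: h; rewrite in_itv /= => /andP[h _].
    exact: le_trans h.
  exists r, u; split => //; last by right; exact: vr.
  rewrite CI; apply/seteqP; split => x /=; rewrite !in_itv /= cr.
    by case=> /andP[_ ->] ->.
  by move=> /andP[h ->]; rewrite h (le_trans (ltW lr) h).
- rewrite k0 in CI *; have [c0|c0] := ltP c 0; [left | right].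
    by rewrite CI -subset0 => x [/= _]; rewrite mul0r add0r leNgt c0.
  exists l, u; split => //; rewrite CI.
  by apply/seteqP; split => x /= => [[]//|h]; split; rewrite // mul0r add0r.
Qed.

Lemma integral_derive_itv (g G : R -> R) l u : l <= u ->
  (forall x, is_derive x 1 G (g x)) -> continuous g -> G l = 0 -> G u = 0 ->
  (\int[lebesgue_measure]_(x in `[l, u]) (g x)%:E = 0)%E.
Proof.
rewrite le_eqVlt => /predU1P[->|lu] dG cg Gl Gu; first by rewrite set_itv1 integral_set1.
have cG : continuous G.
  by move=> x; apply/differentiable_continuous/derivable1_diffP; case: (dG x).
rewrite (@continuous_FTC2 _ g G) //.
- by rewrite Gl Gu subee.
- exact: continuous_subspaceT.
- split; first by move=> x _; case: (dG x).
  + exact/cvg_at_right_filter/cG.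
  + exact/cvg_at_left_filter/cG.
- by move=> x _; rewrite derive1E; exact: derive_val.
Qed.

End Slices.

(** * Integration of polynomials over the triangle *)

Section TriangleIntegral.
Variables (R : realType) (K : triangle R).
Local Notation A := (mpoly 2 R).
Local Notation mu := (@lebesgue_measure R \x @lebesgue_measure R)%E.
Implicit Types (p q : A).

Lemma measurable_mev p : measurable_fun [set: R * R] (fun x => mev x p).
Proof.
elim/mpoly2_ind: p => [c|i p IH|p q IHp IHq].
- rewrite (_ : (fun _ => _) = cst c) //; apply/funext => x.
  by rewrite linearZ /= rmorph1 mulr1.
- rewrite (_ : (fun _ => _) = (fun x => (if i == ord0 then x.1 else x.2) * mev x p)).
    apply: measurable_funM => //; case: (i == ord0);
    [exact: measurable_fst | exact: measurable_snd].
  by apply/funext => x; rewrite rmorphM /= mev_coordX.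
- rewrite (_ : (fun _ => _) = (fun x => mev x p + mev x q)).
    exact: measurable_funD.
  by apply/funext => x; rewrite rmorphD.
Qed.

Lemma continuous_mev p : continuous (fun x : R * R => mev x p).
Proof.
elim/mpoly2_ind: p => [c|i p IH|p q IHp IHq].
- rewrite (_ : (fun _ => _) = cst c) //; first by move=> x; exact: cst_continuous.
  by apply/funext => x; rewrite linearZ /= rmorph1 mulr1.
- rewrite (_ : (fun _ => _) = (fun x => (if i == ord0 then x.1 else x.2) * mev x p)).
    move=> x; apply: continuousM; last exact: IH.
    by case: (i == ord0); [exact: cvg_fst | exact: cvg_snd].
  by apply/funext => x; rewrite rmorphM /= mev_coordX.
- rewrite (_ : (fun _ => _) = (fun x => mev x p + mev x q)).
    by move=> x; apply: continuousD; [exact: IHp | exact: IHq].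
  by apply/funext => x; rewrite rmorphD.
Qed.

Lemma lambda_comb t1 t2 t3 : t1 + t2 + t3 = 1 ->
  let x := t1 *: vtx1 K + t2 *: vtx2 K + t3 *: vtx3 K in
  [/\ lambda1 K x = t1, lambda2 K x = t2 & lambda3 K x = t3].
Proof.
move=> hs; have -> : t1 = 1 - t2 - t3 by rewrite -hs; ring.
rewrite /lambda1 /lambda2 /lambda3; move: (vtx_nondegenerate K).
case: (vtx1 K) => a1 a2; case: (vtx2 K) => b1 b2; case: (vtx3 K) => c1 c2.
by rewrite /sarea /= /GRing.scale /= => n0; split; field.
Qed.

Lemma tri_setE : tri_set K =
  [set x | [&& 0 <= mev x (bary1 K), 0 <= mev x (bary2 K) & 0 <= mev x (bary3 K)]].
Proof.
apply/seteqP; split => x; rewrite /mkset mev_bary1 mev_bary2 mev_bary3; last first.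
  case/and3P => h1 h2 h3; exists (lambda1 K x), (lambda2 K x), (lambda3 K x).
  by split; [exact: h1|exact: h2|exact: h3|exact: lambda_sum | exact: lambda_decomp].
case=> t1 [t2 [t3 [h1 h2 h3 hs ->]]].
by have [-> -> ->] := lambda_comb hs; rewrite h1 h2.
Qed.

Lemma measurable_tri : measurable (tri_set K).
Proof.
have pos p : measurable [set x : R * R | 0 <= mev x p].
  have -> : [set x : R * R | 0 <= mev x p] =
      setT `&` (fun x => mev x p) @^-1` [set` `[0, +oo[].
    by apply/seteqP; split => x /=; rewrite in_itv /= andbT; [split | case].
  exact: measurable_mev.
rewrite tri_setE (_ : [set x | _] = [set x | 0 <= mev x (bary1 K)] `&`
   ([set x | 0 <= mev x (bary2 K)] `&` [set x | 0 <= mev x (bary3 K)])).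
  by apply: measurableI => //; exact: measurableI.
apply/seteqP; split => x /=; first by case/and3P.
by case=> -> [-> ->].
Qed.

Definition tri_bound : R :=
  `|(vtx1 K).1| + `|(vtx2 K).1| + `|(vtx3 K).1| +
  (`|(vtx1 K).2| + `|(vtx2 K).2| + `|(vtx3 K).2|).

Lemma tri_bounded x : tri_set K x -> `|x.1| <= tri_bound /\ `|x.2| <= tri_bound.
Proof.
case=> t1 [t2 [t3 [h1 h2 h3 hs ->]]] /=.
have B (a1 a2 a3 : R) : `|t1 * a1 + t2 * a2 + t3 * a3| <= `|a1| + `|a2| + `|a3|.
  have m (t a : R) : 0 <= t -> t <= 1 -> `|t * a| <= `|a|.
    by move=> t0 t1'; rewrite normrM ger0_norm // ler_piMl.
  rewrite (le_trans (ler_normD _ _)) // lerD ?m //; last lra.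
  by rewrite (le_trans (ler_normD _ _)) // lerD ?m //; lra.
split; rewrite (le_trans (B _ _ _)) // /tri_bound ?lerDl ?lerDr !addr_ge0 //.
Qed.

Lemma tri_bound_ge0 : 0 <= tri_bound.
Proof. by rewrite /tri_bound !addr_ge0. Qed.

Lemma mev_bounded p : exists M, forall x, tri_set K x -> `|mev x p| <= M.
Proof.
elim/mpoly2_ind: p => [c|i p [M IH]|p q [M IHp] [N IHq]].
- by exists `|c| => x _; rewrite linearZ /= rmorph1 mulr1.
- exists (tri_bound * M) => x Kx; rewrite rmorphM /= normrM mev_coordX.
  have [b1 b2] := tri_bounded Kx.
  by rewrite ler_pM //; [case: ifP | exact: IH].
- exists (M + N) => x Kx; rewrite rmorphD /= (le_trans (ler_normD _ _)) //.
  by rewrite lerD ?IHp ?IHq.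
Qed.

Lemma tri_finite : (mu (tri_set K) < +oo)%E.
Proof.
pose I : set R := [set` `[- tri_bound, tri_bound]].
have sub : tri_set K `<=` I `*` I.
  by move=> x /tri_bounded[]; rewrite /I /= !in_itv /= -!ler_norml.
have le : (mu (tri_set K) <= mu (I `*` I))%E.
  apply: le_measure => //; rewrite inE; first exact: measurable_tri.
  by apply: measurableX; exact: measurable_itv.
apply: le_lt_trans le _.
rewrite product_measure1E; [|exact: measurable_itv..].
rewrite /I /= lebesgue_measure_itv /=.
by case: ifP; rewrite ?mule0 ?ltry // -EFinB -EFinM ltry.
Qed.

Lemma mev_integrable p : mu.-integrable (tri_set K) (EFin \o (fun x => mev x p)).
Proof.
apply: measurable_bounded_integrable.
- exact: measurable_tri.
- exact: tri_finite.
- exact: measurable_funTS (measurable_mev p).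
- have [M hM] := mev_bounded p; exists M; split; first exact: num_real.
  by move=> N MN x Kx; exact: le_trans (hM _ Kx) (ltW MN).
Qed.

Definition tri_int p : R := (\int[mu]_(x in tri_set K) mev x p)%R.

Lemma tri_int_linear : linear (tri_int : A -> R^o).
Proof.
move=> a p q; rewrite /tri_int; have mK := measurable_tri.
transitivity (\int[mu]_(x in tri_set K) (mev x (a *: p) + mev x q))%R.
  by apply: eq_Rintegral => x _; rewrite rmorphD.
rewrite RintegralD //; [|exact: mev_integrable..]; congr (_ + _).
transitivity (\int[mu]_(x in tri_set K) (a * mev x p))%R.
  by apply: eq_Rintegral => x _; rewrite linearZ.
by rewrite RintegralZl //; exact: mev_integrable.
Qed.
HB.instance Definition _ := GRing.isLinear.Build R A R^o *:%R tri_int tri_int_linear.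

End TriangleIntegral.

(** * The divergence theorem on the triangle *)

Section Stokes.
Variables (R : realType) (K : triangle R).
Local Notation A := (mpoly 2 R).
Local Notation leb := (@lebesgue_measure R).
Local Notation mu := (leb \x leb)%E.
Implicit Types (p q : A).

Definition bubble_poly : A := bary1 K * bary2 K * bary3 K.

Definition axis_pt (b : bool) (t z : R) : R * R := if b then (t, z) else (z, t).
Definition axis_ord (b : bool) : 'I_2 := if b then ord0 else ord_max.

Lemma is_derive_axis (b : bool) (z : R) p (t : R) :
  is_derive t (1 : R) (fun t : R => mev (axis_pt b t z) p)
    (mev (axis_pt b t z) (mderiv (axis_ord b) p)).
Proof.
elim/mpoly2_ind: p => [c|i p IH|p q IHp IHq].
- have -> : (fun t => mev (axis_pt b t z) c%:A) = cst c.
    by apply/funext => s; rewrite linearZ /= rmorph1 mulr1.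
  rewrite alg_mpolyC mderivC rmorph0; exact: is_derive_cst.
- have -> : (fun t => mev (axis_pt b t z) (coordX R i * p)) =
      (fun t => if i == axis_ord b then t else z) * (fun t => mev (axis_pt b t z) p).
    apply/funext => s; rewrite rmorphM /= mev_coordX; congr (_ * _).
    by case: (unliftP ord0 i) => [j|] ->; rewrite ?ord1; case: b {IH}.
  have dX : is_derive t (1 : R) (fun t : R => if i == axis_ord b then t else z)
      (if i == axis_ord b then 1 else 0).
    case: (i == axis_ord b); [exact: is_derive_id | exact: is_derive_cst].
  apply: (is_derive_eq (is_deriveM dX IH)).
  rewrite mderivM rmorphD !rmorphM /= mev_coordX.
  have -> : mderiv (axis_ord b) (coordX R i) = (i == axis_ord b)%:R.
    rewrite /coordX mderivX mnm1E; case: eqP => [->|_]; last by rewrite scale0r.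
    rewrite scale1r -mpolyX0; congr (mpolyX _ _).
    by apply/mnmP => k; rewrite mnmBE subnn mnm0E.
  rewrite rmorph_nat addrC; congr (_ + _).
    by rewrite mulrC /GRing.scale /=; case: (i == _).
  rewrite /GRing.scale /=; congr (_ * _).
  by case: (unliftP ord0 i) => [j|] ->; rewrite ?ord1; case: b {IH dX}.
- have -> : (fun t => mev (axis_pt b t z) (p + q)) =
      (fun t => mev (axis_pt b t z) p) + (fun t => mev (axis_pt b t z) q).
    by apply/funext => s; rewrite rmorphD.
  apply: (is_derive_eq (is_deriveD IHp IHq)).
  by rewrite mderivD rmorphD.
Qed.

(** The fundamental theorem of calculus on a slice of the triangle: the bubble
    vanishes at the ends, where one of the barycentric coordinates does. *)
Lemma integral_slice (b : bool) (z : R) p :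
  (\int[leb]_t (((fun x => mev x (mderiv (axis_ord b) (bubble_poly * p))) \_ (tri_set K))
     (axis_pt b t z))%:E = 0)%E.
Proof.
set f := fun x => mev x _.
pose cf (a : R * R * R) : R * R :=
  if b then (a.1.1, a.1.2 * z + a.2) else (a.1.2, a.1.1 * z + a.2).
have cfE a1 a2 a3 t : mev (axis_pt b t z) (affine a1 a2 a3) =
    (cf (a1, a2, a3)).1 * t + (cf (a1, a2, a3)).2.
  by rewrite mev_affine /cf; case: (b) => /=; ring.
have [h1 [h2 [h3 [E1 E2 E3]]]] : exists h1 h2 h3 : R * R,
   [/\ forall t, mev (axis_pt b t z) (bary1 K) = h1.1 * t + h1.2,
       forall t, mev (axis_pt b t z) (bary2 K) = h2.1 * t + h2.2 &
       forall t, mev (axis_pt b t z) (bary3 K) = h3.1 * t + h3.2].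
  by do 3 eexists; split => t; exact: cfE.
(* M exceeds the bound, so that -M and M cannot be ends of the slice *)
pose M := tri_bound K + 1; have M0 : - M <= M.
  by have := tri_bound_ge0 K; rewrite /M; lra.
pose C : set R := [set t | tri_set K (axis_pt b t z)].
have CE : C = [set t | - M <= t <= M /\
    all (fun h => 0 <= h.1 * t + h.2) [:: h1; h2; h3]].
  rewrite /C tri_setE; apply/seteqP; split => t /=; rewrite E1 E2 E3 andbT; last by case.
  move=> h; split => //.
  have : tri_set K (axis_pt b t z) by rewrite tri_setE /= E1 E2 E3.
  move=> /tri_bounded; rewrite /M -ler_norml; case: (b) => /= -[] ? ?; lra.
have -> : (\int[leb]_t ((f \_ (tri_set K)) (axis_pt b t z))%:E =
    \int[leb]_(t in C) (f (axis_pt b t z))%:E)%E.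
  rewrite [RHS]integral_mkcond; apply: eq_integral => t _.
  rewrite /patch; case: ifPn => h; case: ifPn => h' //.
    by move: h'; rewrite notin_setE => -[]; move: h; rewrite inE.
  by move: h; rewrite notin_setE => -[]; move: h'; rewrite inE.
have [C0|[l [u [lu Clu vl vu]]]] := affine_slice [:: h1; h2; h3] M0.
  by rewrite CE C0 integral_set0.
have end0 t : [set` `[l, u]] t ->
    t = - M \/ t = M \/ has (fun h => h.1 * t + h.2 == 0) [:: h1; h2; h3] ->
    mev (axis_pt b t z) (bubble_poly * p) = 0.
  rewrite -Clu -CE => /tri_bounded Ct vt.
  have {}vt : has (fun h => h.1 * t + h.2 == 0) [:: h1; h2; h3].
    have tM : `|t| <= tri_bound K by move: Ct; case: (b) => -[].
    move: tM; rewrite ler_norml; have := tri_bound_ge0 K.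
    by case: vt => [->|[->|//]]; rewrite /M => ? /andP[? ?]; exfalso; lra.
  rewrite !rmorphM /= E1 E2 E3; move: vt => /= /or4P[] // /eqP ->;
    by rewrite ?mul0r ?mulr0 ?mul0r.
rewrite CE Clu.
apply: (@integral_derive_itv _ _ (fun t => mev (axis_pt b t z) (bubble_poly * p))) => //.
- by move=> x; exact: is_derive_axis.
- move=> t; apply/differentiable_continuous/derivable1_diffP.
  by case: (is_derive_axis b z (mderiv (axis_ord b) (bubble_poly * p)) t).
- apply: end0; first by rewrite /= in_itv /= lexx.
  by case: vl; [left | right; right].
- apply: end0; first by rewrite /= in_itv /= lexx lu.
  by case: vu; [right; left | right; right].
Qed.

Lemma tri_int_mderiv b p : tri_int K (mderiv (axis_ord b) (bubble_poly * p)) = 0.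
Proof.
rewrite /tri_int Rintegral_mkcond /Rintegral; set q := mderiv _ _.
have int : mu.-integrable setT (EFin \o ((fun x => mev x q) \_ (tri_set K))).
  rewrite -restrict_EFin; apply: (iffLR (integrable_mkcond _ _)).
    exact: measurable_tri.
  exact: mev_integrable.
case: b @q int => q int.
- rewrite -(integral21_prod_meas1 int) /fubini_G integral0_eq // => z _.
  exact: (integral_slice true z p).
- rewrite -(integral12_prod_meas1 int) /fubini_F integral0_eq // => z _.
  exact: (integral_slice false z p).
Qed.

Lemma tri_int_dirder v p : tri_int K (dirder v (bubble_poly * p)) = 0.
Proof.
rewrite /dirder linearD 2!linearZ /=.
by rewrite (tri_int_mderiv true) (tri_int_mderiv false) !scaler0 addr0.
Qed.

End Stokes.

(** * A polynomial whose square integrates to zero *)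

Section Positivity.
Variables (R : realType) (K : triangle R).
Local Notation A := (mpoly 2 R).
Local Notation leb := (@lebesgue_measure R).
Local Notation mu := (leb \x leb)%E.
Implicit Types (p q : A) (x y : R * R).

Definition tri_interior : set (R * R) :=
  [set x | [/\ 0 < mev x (bary1 K), 0 < mev x (bary2 K) & 0 < mev x (bary3 K)]].

Lemma nbhs_square x (P : set (R * R)) : nbhs x P ->
  exists2 e : R, 0 < e & forall y, `|x.1 - y.1| < e -> `|x.2 - y.2| < e -> P y.
Proof.
by move=> /nbhs_ballP[e e0 eP]; exists e => // y y1 y2; apply: eP; split.
Qed.

Lemma nbhs_mev_gt0 x p : 0 < mev x p -> \forall y \near x, 0 < mev y p.
Proof.
by move=> px; have /(_ _ (lt_nbhsr px)) := @continuous_mev R p x.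
Qed.

Lemma nbhs_mev_neq0 x p : mev x p != 0 -> \forall y \near x, mev y p != 0.
Proof.
move=> px; have : 0 < mev x (p ^+ 2) by rewrite rmorphXn /= exprn_even_gt0.
move/nbhs_mev_gt0 => h; near=> y.
have : 0 < mev y (p ^+ 2) by near: y; exact: h.
by rewrite rmorphXn /= exprn_even_gt0.
Unshelve. all: by end_near.
Qed.

(** Otherwise the square would be positive on a small square inside the triangle,
    whereas it vanishes almost everywhere. *)
Lemma tri_int_sqr_interior p : tri_int K (p ^+ 2) = 0 ->
  forall x, tri_interior x -> mev x p = 0.
Proof.
move=> I0 x [x1 x2 x3]; apply/eqP/negPn/negP => px.
have [e e0 eP] : exists2 e : R, 0 < e &
    forall y, `|x.1 - y.1| < e -> `|x.2 - y.2| < e -> tri_set K y /\ mev y p != 0.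
  apply: nbhs_square; near=> y; split; last by near: y; exact: nbhs_mev_neq0.
  by rewrite tri_setE; apply/and3P; split; apply: ltW; near: y; exact: nbhs_mev_gt0.
pose f : R * R -> R := fun y => mev y (p ^+ 2).
have mf : measurable_fun (tri_set K) (EFin \o f).
  by apply/measurable_EFinP; exact: measurable_funTS (measurable_mev _).
have int0 : (\int[mu]_(x in tri_set K) `|(EFin \o f) x| = 0)%E.
  transitivity (\int[mu]_(x in tri_set K) (EFin \o f) x)%E.
    by apply: eq_integral => y _ /=; rewrite ger0_norm // /f rmorphXn /= sqr_ge0.
  rewrite -[LHS]fineK; first by congr (_%:E).
  apply: integrable_fin_num; first exact: measurable_tri.
  exact: (mev_integrable K (p ^+ 2)).
have [N [mN N0 KN]] : ae_eq mu (tri_set K) (EFin \o f) (cst 0%E).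
  apply: (iffLR (ae_eq_integral_abs mu _ _) int0); first exact: measurable_tri.
  exact: mf.
pose I t : set R := [set` `]t - e, t + e[].
have sub : I x.1 `*` I x.2 `<=` N.
  move=> y [/= y1 y2]; apply: KN => /= h.
  have [||Ky /eqP py] := eP y; rewrite ?ltr_distlC //.
  apply: py; have := h Ky; rewrite /f rmorphXn /= => -[] /eqP.
  by rewrite expf_eq0 /= => /eqP.
have : (mu (I x.1 `*` I x.2) <= mu N)%E.
  by apply: le_measure => //; rewrite inE //; apply: measurableX; exact: measurable_itv.
rewrite N0 product_measure1E; [|exact: measurable_itv..].
rewrite /I /= !lebesgue_measure_itv /= !lte_fin !ifT; [|lra..].
by rewrite -!EFinD -EFinM lee_fin leNgt mulr_gt0 //; lra.
Unshelve. all: by end_near.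
Qed.

(** Moving any point of the triangle a little towards the centroid makes its
    barycentric coordinates positive, and polynomials are continuous. *)
Lemma tri_interior_dense p : (forall x, tri_interior x -> mev x p = 0) ->
  forall x, tri_set K x -> mev x p = 0.
Proof.
move=> p0 x Kx; apply/eqP/negPn/negP => px.
have [e e0 eP] := nbhs_square (nbhs_mev_neq0 px).
pose c : R * R := (3^-1 : R) *: vtx1 K + (3^-1 : R) *: vtx2 K + (3^-1 : R) *: vtx3 K.
have h3 : 0 < 3^-1 :> R by rewrite invr_gt0 ltr0n.
have s3 : 3^-1 + 3^-1 + 3^-1 = 1 :> R by field.
have Kc : tri_set K c by exists 3^-1, 3^-1, 3^-1; split; rewrite // ltW.
pose M := tri_bound K; have M0 : 0 <= M := tri_bound_ge0 K.
(* any t with 0 < t < 1 and t * (M + M) < e would do *)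
pose t := e / (e + (M + M) + 1).
have d0 : 0 < e + (M + M) + 1 by lra.
have t0 : 0 < t by rewrite divr_gt0.
have t1 : t < 1 by rewrite ltr_pdivrMr // mul1r; lra.
have tM : t * (M + M) < e.
  by rewrite /t mulrAC ltr_pdivrMr // ltr_pM2l //; lra.
pose y : R * R := (x.1 + t * (c.1 - x.1), x.2 + t * (c.2 - x.2)).
have [cx1 cx2] := tri_bounded Kc; have [xx1 xx2] := tri_bounded Kx.
have close (a b : R) : `|a| <= M -> `|b| <= M -> `|a - (a + t * (b - a))| < e.
  move=> ha hb; rewrite opprD addrA subrr add0r normrN normrM (gtr0_norm t0).
  apply: le_lt_trans tM; rewrite ler_pM2l // (le_trans (ler_normB _ _)) //.
  exact: lerD.
have /negP := eP y (close _ _ xx1 cx1) (close _ _ xx2 cx2); apply; apply/eqP/p0.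
have comb q (a b d : R) : q = affine a b d -> mev y q = (1 - t) * mev x q + t * mev c q.
  by move=> ->; rewrite !mev_affine /=; ring.
have [l1 l2 l3] := lambda_comb K s3.
move: Kx; rewrite tri_setE => /and3P[k1 k2 k3].
have pos (u : R) : 0 <= u -> 0 < (1 - t) * u + t * 3^-1.
  move=> u0; apply: (@lt_le_trans _ _ (t * 3^-1)); first exact: mulr_gt0.
  by rewrite lerDr mulr_ge0 // subr_ge0 ltW.
by split; rewrite (comb _ _ _ _ erefl) ?mev_bary1 ?mev_bary2 ?mev_bary3 ?l1 ?l2 ?l3;
  apply: pos; rewrite -?mev_bary1 -?mev_bary2 -?mev_bary3.
Qed.

End Positivity.

(** * The space R^n(K) *)

Section JacobiTriangle.
Variables (R : realType) (K : triangle R).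
Local Notation A := (mpoly 2 R).
Local Notation S := (baryS K).
Local Notation D := (baryD K).
Local Notation U := (jacobi_alg S D).
Local Notation b := (bubble_poly K).
Implicit Types (p q : A).

Lemma bubble_polyE : (1 - S) * (S ^+ 2 - D ^+ 2) = b * 4%:R.
Proof. by rewrite -bary1E /bubble_poly /baryS /baryD; ring. Qed.

Lemma mev_bubble_poly x : mev x b = bubble K x.
Proof. by rewrite !rmorphM /= mev_bary1 mev_bary2 mev_bary3. Qed.

Lemma tri_int_jacobi_orth k n q : (k <= n)%N -> (msize q <= n)%N ->
  tri_int K (b ^+ 2 * U k n * q) = 0.
Proof.
case: n => [|n] kn sq.
  move: sq; rewrite leqn0 mmeasure_poly_eq0 => /eqP ->.
  by rewrite mulr0 linear0.
apply: (@baryS_baryD_ind R K (fun q => tri_int K (b ^+ 2 * U k n.+1 * q) = 0) n) sq.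
- by rewrite mulr0 linear0.
- move=> a q1 q2 E1 E2.
  by rewrite mulrDr -scalerAr linearD linearZ /= E1 E2 scaler0 addr0.
move=> i j ij.
have I0 v p : tri_int K (dirder v ((1 - S) * (S ^+ 2 - D ^+ 2) * p)) = 0.
  by rewrite bubble_polyE -mulrA; exact: tri_int_dirder.
have := @jacobi_alg_orth R A S D (dirder (dirS K)) (dirder (dirD K)) (tri_int K)
  (@dirderM _ _) (@dirderM _ _) (dirS_S K) (dirS_D K) (dirD_S K) (dirD_D K)
  (I0 _) (I0 _) k n.+1 i j kn ij.
rewrite bubble_polyE; have -> : (b * 4%:R) ^+ 2 * U k n.+1 * (S ^+ i * D ^+ j) =
    16%:R *: (b ^+ 2 * U k n.+1 * (S ^+ i * D ^+ j)).
  by rewrite scaler_nat; ring.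
by rewrite linearZ /= => /eqP; rewrite mulf_eq0 pnatr_eq0 /= => /eqP.
Qed.

(** Where [lambda2 + lambda3 = 0] on the triangle, [lambda2 - lambda3] is zero as
    well; [s ^+ k * P_k(d / s)] and the homogenization of [P_k] are then both zero
    for [k > 0], and the same constant for [k = 0]. *)
Lemma jacobi_triE k n (x : tri_set K) :
  jacobi_tri K 2 2 2 k n x = mev (\val x) (U k n).
Proof.
have pos y : tri_set K y ->
    [&& 0 <= mev y (bary1 K), 0 <= mev y (bary2 K) & 0 <= mev y (bary3 K)].
  by rewrite tri_setE.
have := pos _ (set_valP x); rewrite mev_bary1 mev_bary2 mev_bary3 => /and3P[_ h2 h3].
rewrite /jacobi_tri /jacobi_alg rmorphM /= mev_horner_alg horner_comp.
have l1 := lambda_sum K (\val x).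
rewrite [RHS]mulrC [LHS]mulrAC [LHS]mulrC [RHS]mulrC; congr (_ * _).
  congr (_.[_]); rewrite !hornerE rmorphD /= mev_bary2 mev_bary3.
  by lra.
rewrite /homogenize rmorph_sum /=; set s := _ + _; set d := _ - _.
have Ss : mev (\val x) S = s by rewrite rmorphD /= mev_bary2 mev_bary3.
have Dd : mev (\val x) D = d by rewrite rmorphB /= mev_bary2 mev_bary3.
transitivity (\sum_(i < k.+1) (jacobi k 2 2)`_i * (d ^+ i * s ^+ (k - i))); last first.
  by apply: eq_bigr => i _; rewrite linearZ /= rmorphM !rmorphXn /= Ss Dd.
rewrite (@horner_coef_wide _ k.+1) ?(size_jacobi R k 2 2) // mulr_sumr.
have [s0|s0] := eqVneq s 0.
  have d0 : d = 0 by move: s0; rewrite /s /d; lra.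
  apply: eq_bigr => i _; rewrite s0 d0 mul0r.
  case: k i => [|k] i; first by rewrite ord1 !expr0; ring.
  case: i => [[|i] hi] /=; first by rewrite subn0 !expr0n /=; ring.
  by rewrite !expr0n /=; ring.
apply: eq_bigr => i _; rewrite mulrCA; congr (_ * _).
have ik : (i <= k)%N by rewrite -ltnS.
by rewrite -{1}(subnK ik) exprD -mulrA -exprMn mulrCA mulfV // mulr1 mulrC.
Qed.

(** [poly_space K (n - 1)] uniformly in [n]: for [n = 0] the polynomials of size at
    most [0] are the zero polynomial, in accordance with degree [-1]. *)
Lemma poly_space_predP n (f : tri_set K -> R) : poly_space (n%:Z - 1) f <->
  exists2 p : A, (msize p <= n)%N & forall x, f x = mev (\val x) p.
Proof.
case: n => [|n]; last by rewrite (_ : n.+1%:Z - 1 = n%:Z); [exact: iff_refl | lia].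
rewrite (_ : 0%:Z - 1 = Negz 0) //; split=> [f0|[p]].
  by exists 0; [rewrite mmeasure0 | move=> x; rewrite rmorph0; exact: f0].
rewrite leqn0 mmeasure_poly_eq0 => /eqP -> f0; rewrite /poly_space /mkset => x.
by rewrite f0 rmorph0.
Qed.

Lemma integral_tri_mev p (f : tri_set K -> R) : (forall x, f x = mev (\val x) p) ->
  integral_tri f = tri_int K p.
Proof.
move=> fE; have -> : f = sigL (tri_set K) (fun x => mev x p).
  by apply/funext => x; exact: fE.
rewrite /integral_tri /tri_int; apply: eq_Rintegral => x Kx.
have := congr1 (fun F => F (fun x => mev x p) x) (@sigLK _ _ (0:R) (tri_set K)).
by rewrite /= /patch Kx.
Qed.

Lemma R_space_eq_span n : R_space K n.+2 =
  lin_span (fun k : 'I_n.+1 => jacobi_tri K 2 2 2 k n).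
Proof.
rewrite /R_space.
have -> : n.+2%:Z - 2 = n.+1%:Z - 1 by lia.
have -> : n.+2%:Z - 3 = n%:Z - 1 by lia.
have intE v q (f : tri_set K -> R) g : (forall x, f x = mev (\val x) v) ->
   (forall x, g x = mev (\val x) q) ->
   integral_tri (fun x => bubble K (\val x) ^+ 2 * f x * g x) =
     tri_int K (b ^+ 2 * v * q).
  move=> fE gE; apply: integral_tri_mev => x.
  by rewrite fE gE 2!rmorphM rmorphXn /= mev_bubble_poly.
have orth (c : 'I_n.+1 -> R) q : (msize q <= n)%N ->
    tri_int K (b ^+ 2 * (\sum_(k < n.+1) c k *: U k n) * q) = 0.
  move=> sq; rewrite mulr_sumr mulr_suml linear_sum big1 // => k _.
  by rewrite -scalerAr -scalerAl linearZ /= tri_int_jacobi_orth ?scaler0 // -ltnS.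
have sumE (c : 'I_n.+1 -> R) x : \sum_(k < n.+1) c k * jacobi_tri K 2 2 2 k n x =
    mev (\val x) (\sum_(k < n.+1) c k *: U k n).
  rewrite rmorph_sum /=; apply: eq_bigr => k _.
  by rewrite jacobi_triE linearZ.
apply/seteqP; split => v; rewrite /mkset.
- case=> /poly_space_predP[p sp vE] vorth.
  have [c [w [sw pE]]] := jacobi_alg_span K sp.
  exists c => x; rewrite sumE vE pE rmorphD /= [X in _ + X](_ : _ = 0) ?addr0 //.
  (* w is orthogonal to itself, since both v and the Jacobi part of v are *)
  have Ibw : tri_int K ((b * w) ^+ 2) = 0.
    have <- := vorth (fun x => mev (\val x) w); last first.
      by apply/poly_space_predP; exists w.
    rewrite (intE p w) // pE mulrDr mulrDl linearD /= orth // add0r.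
    by congr (tri_int K _); ring.
  apply: tri_interior_dense (set_valP x) => y yi.
  have := tri_int_sqr_interior Ibw yi; case: yi => y1 y2 y3.
  rewrite !rmorphM /= => /eqP.
  by rewrite !mulf_eq0 (gt_eqF y1) (gt_eqF y2) (gt_eqF y3) => /eqP.
- case=> c vE; split.
    apply/poly_space_predP; exists (\sum_(k < n.+1) c k *: U k n).
      apply: msize_sum_le => k _; apply: msize_scale_le.
      by rewrite msize_jacobi_alg // -ltnS.
    by move=> x; rewrite vE sumE.
  move=> q /poly_space_predP[p sp qE].
  rewrite (intE (\sum_(k < n.+1) c k *: U k n) p) // ?orth // => x.
  by rewrite vE sumE.
Qed.

End JacobiTriangle.

Local Close Scope ring_scope.
Local Close Scope classical_set_scope.

Theorem lemma3p7 (R : realType) (r : nat) (hr : (2 <= r)%N) (K : triangle R) :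
  R_space K r =
  lin_span (fun k : 'I_(r - 2).+1 => jacobi_tri K 2%R 2%R 2%R k (r - 2)).
Proof.
move: hr; case: r => [//|[//|n]] _; have -> : (n.+2 - 2 = n)%N by lia.
exact: R_space_eq_span.
Qed.
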